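(* Let $L$ be a positive-definite even lattice with $\Phi(L)\neq\emptyset$, and let $\Delta(L)=\{\alpha_1,\dots,\alpha_k\}$ be a basis of the root system $\Phi(L)$. Assume $\Delta(L)$ can be extended to a basis of $L$, i.e. $L=Q(L)\oplus\mathbb{Z}\alpha_{k+1}\oplus\cdots\oplus\mathbb{Z}\alpha_r$ with $Q(L)=\mathbb{Z}\Phi(L)$, where $\Delta(L)\cup\{\alpha_{k+1},\dots,\alpha_r\}$ is an $\mathbb{R}$-basis of the Euclidean space $E$. Let $\mathfrak{b}$ (resp. $\mathfrak{p}$) be a Borel (resp. parabolic) Lie subalgebra of the reductive Lie algebra $\mathfrak{g}=(V_L)_1$ that contains $\mathfrak{h}=\mathrm{span}\{h(-1)\mathbf{1}:h\in\mathfrak{h}\}\subset(V_L)_1$. Then there exists a Borel-type subVOA $V_B\le V_L$ such that $\mathfrak{b}=(V_B)_1$, and a parabolic-type subVOA $V_P\le V_L$ such that $\mathfrak{p}\subseteq(V_P)_1$.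
   Context: $L$ is a positive-definite even lattice spanned over $\mathbb{Z}$ by an $\mathbb{R}$-basis of a Euclidean space $(E,(\cdot|\cdot))$; $\Phi(L)=\{\alpha\in L:(\alpha|\alpha)=2\}$, which when nonempty is a root system (ADE-type). For $0\ne\gamma\in E$ put $P(\gamma)=\{v\in E:(\gamma|v)=0\}$ and $P^{\ge0}(\gamma)=\{v\in E:(\gamma|v)\ge0\}$. A submonoid of $L$ is a subset containing $0$ and closed under addition. A submonoid $B\le L$ is of Borel-type if $B\cup(-B)=L$, $B\cap(-B)=\{0\}$, and there is a hyperplane $P(\gamma)\subset E$ with $B\subset P^{\ge0}(\gamma)$. A submonoid $P\le L$ is of parabolic-type if it contains a Borel-type submonoid. Lattice VOA. Put $\mathfrak{h}=\mathbb{C}\otimes_{\mathbb{Z}}L$ with the $\mathbb{C}$-bilinear extension of $(\cdot|\cdot)$, and $\hat{\mathfrak{h}}=\mathfrak{h}\otimes\mathbb{C}[t,t^{-1}]\oplus\mathbb{C}K$ with $K$ central, $h(m)=h\otimes t^m$, $[h_1(m),h_2(n)]=m\delta_{m+n,0}(h_1|h_2)K$. For $\lambda\in\mathfrak{h}$, $M_{\hat{\mathfrak{h}}}(1,\lambda)=U(\hat{\mathfrak{h}})\otimes_{U(\hat{\mathfrak{h}}_{\ge 0})}\mathbb{C}e^\lambda$, where $\hat{\mathfrak{h}}_{\ge 0}=\mathfrak{h}\otimes\mathbb{C}[t]\oplus\mathbb{C}K$ acts by $K=1$, $h(0)e^\lambda=(h|\lambda)e^\lambda$, $h(n)e^\lambda=0$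 for $n>0$. Let $\epsilon:L\times L\to\{\pm1\}$ be a 2-cocycle with $\epsilon(\alpha,\beta)\epsilon(\beta,\alpha)=(-1)^{(\alpha|\beta)}$ and $\epsilon(0,\alpha)=\epsilon(\alpha,0)=1$. The lattice VOA is $V_L=\bigoplus_{\alpha\in L}M_{\hat{\mathfrak{h}}}(1,\alpha)=M_{\hat{\mathfrak{h}}}(1,0)\otimes\mathbb{C}^\epsilon[L]$ with vacuum $\mathbf{1}=e^0$, $Y(h(-1)\mathbf{1},z)=\sum_{n}h(n)z^{-n-1}$, $Y(e^\alpha,z)=\exp\big(\sum_{n>0}\frac{\alpha(-n)}{n}z^n\big)\exp\big(-\sum_{n>0}\frac{\alpha(n)}{n}z^{-n}\big)e_\alpha z^\alpha$, where $e_\alpha(w\otimes e^\beta)=\epsilon(\alpha,\beta)w\otimes e^{\alpha+\beta}$ and $z^\alpha$ acts on $M_{\hat{\mathfrak{h}}}(1,\beta)$ as $z^{(\alpha|\beta)}$; $Y$ of a general $h_1(-n_1-1)\cdots h_k(-n_k-1)e^\alpha$ is the normally ordered product of the $\frac{1}{n_i!}\partial_z^{n_i}h_i(z)$ and $Y(e^\alpha,z)$. The weight of $h_1(-n_1)\cdots h_k(-n_k)e^\alpha$ is $n_1+\cdots+n_k+(\alpha|\alpha)/2$; for a subVOA $V$, $V_1$ denotes its weight-one subspace. For a submonoid $M\le L$, $V_M=\bigoplus_{\gamma\in M}M_{\hat{\mathfrak{h}}}(1,\gamma)$ is a subVOA of $V_L$. $V_B$ (resp. $V_P$) with $B$ of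 Borel-type (resp. $P$ of parabolic-type) is called a Borel-type (resp. parabolic-type) subVOA. For a CFT-type VOA $V$, $V_1$ is a Lie algebra with bracket $[a,b]=a_0b=\mathrm{Res}_zY(a,z)b$. The Lie algebra $(V_L)_1=\mathfrak{h}+\sum_{\alpha\in\Phi(L)}\mathbb{C}e^\alpha$ is reductive. A parabolic subalgebra is one that contains a Borel (maximal solvable) subalgebra. *)

(* Defs.v *)
From HB Require Import structures.
From mathcomp Require Import all_boot all_order all_algebra.
From mathcomp Require Import finmap multiset.
From mathcomp Require Import boolp classical_sets fsbigop reals.
From mathcomp Require Import complex monalg.

Set Implicit Arguments.
Unset Strict Implicit.
Unset Printing Implicit Defensive.

Import Order.TTheory GRing.Theory Num.Theory.

Local Open Scope classical_set_scope.
Local Open Scope ring_scope.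
Local Open Scope complex_scope.

(* A positive-definite even lattice: the integral span of an R-basis
   (lbasis i) of the Euclidean space ambient.  A lattice vector is represented
   by the row of its integral coordinates in this basis. *)
Record evenLattice (R : realType) := EvenLattice {
  ambient : vectType R;
  ip : {dot ambient for idfun};
  rk : nat;
  lbasis : rk.-tuple ambient;
  lbasisP : basis_of fullv lbasis;
  ip_even : forall a : 'rV[int]_rk,
    let x := \sum_(i < rk) (a 0 i)%:~R *: tnth lbasis i in
    exists m : int, ip x x = (2 * m)%:~R
}.

Section Lattice.
Variables (R : realType) (L : evenLattice R).

Definition lvec := 'rV[int]_(rk L).

Definition emb (a : lvec) : ambient L :=
  \sum_(i < rk L) (a 0 i)%:~R *: tnth (lbasis L) i.

Definition lip (a b : lvec) : R := ip L (emb a) (emb b).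

(* The form takes integral values on L; lipz is lip, seen in int. *)
Definition lipz (a b : lvec) : int := Num.floor (lip a b).

Definition lroots : set lvec := [set a | lip a a = 2].

Definition Zspan (S : set lvec) : set lvec :=
  [set x | exists (m : nat) (a : 'I_m -> lvec) (c : 'I_m -> int),
     (forall i, S (a i)) /\ x = \sum_(i < m) c i *: a i].

Definition root_lattice : set lvec := Zspan lroots.

(* Delta is a basis (simple system) of the root system, not of E: it is only
   required to be a basis of the R-span of the roots. *)
Definition root_basis (k : nat) (Delta : k.-tuple lvec) :=
  [/\ forall i, lroots (tnth Delta i),
      free (map emb Delta)
    & forall a, lroots a -> exists c : 'I_k -> nat,
        a = \sum_(i < k) tnth Delta i *+ c i \/
        a = - \sum_(i < k) tnth Delta i *+ c i].

Definition submonoid (M : set lvec) :=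
  M 0 /\ forall a b, M a -> M b -> M (a + b).

Definition borel_type (B : set lvec) :=
  [/\ submonoid B,
      B `|` [set - a | a in B] = setT,
      B `&` [set - a | a in B] = [set 0]
    & exists2 gamma : ambient L, gamma != 0 &
        B `<=` [set a | 0 <= ip L gamma (emb a)]].

Definition parabolic_type (P : set lvec) :=
  submonoid P /\ exists2 B, borel_type B & B `<=` P.

Definition cocycle (eps : lvec -> lvec -> int) :=
  [/\ forall a b, eps a b = 1 \/ eps a b = -1,
      forall a b c, eps a b * eps (a + b) c = eps b c * eps a (b + c),
      forall a b, eps a b * eps b a = (-1) ^ (lipz a b)
    & forall a, eps 0 a = 1 /\ eps a 0 = 1].

End Lattice.

Section LatticeVOA.
Variables (R : realType) (L : evenLattice R).
Variable eps : lvec L -> lvec L -> int.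

Local Notation n := (rk L).
Local Notation b i := (tnth (lbasis L) i).

(* The tensor product of C with L over the integers, in the coordinates given
   by the Z-basis of L. *)
Definition hvec := 'rV[R[i]]_n.

Definition hvec_of (a : lvec L) : hvec := map_mx intr a.

Definition hb (i : 'I_n) : hvec := delta_mx 0 i.

Definition hip (h h' : hvec) : R[i] :=
  \sum_(i < n) \sum_(j < n) h 0 i * h' 0 j * (ip L (b i) (b j))%:C.

(* By the PBW theorem the vectors b_{i1}(-k1-1) ... b_{is}(-ks-1) e^a, indexed
   by the pairs of a multiset w = {(i1, k1), ..., (is, ks)} and a lattice
   vector a, form a basis of the direct sum of the induced modules M(1, a),
   so that VL is the space of finite linear combinations of such pairs. *)
Definition pbw : choiceType := ({mset 'I_n * nat}%mset * lvec L)%type.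

Definition VL := {malg R[i][pbw]}.

Definition pbwvec (x : pbw) : VL := << 1 *g x >>.

Definition linext (f : pbw -> VL) (v : VL) : VL :=
  \sum_(x <- msupp v) v@_x *: f x.

Definition expvec (a : lvec L) : VL := pbwvec (mset0, a).

Definition vacuum : VL := expvec 0.

(* The action of h(m), read off from
   [h(k+1), b_j(-k-1)] = (k+1) (h|b_j) and h(k+1) e^a = 0. *)
Definition hmode (h : hvec) (m : int) : VL -> VL :=
  linext (fun x => match m with
    | Posz 0 => hip h (hvec_of x.2) *: pbwvec x
    | Posz k.+1 => \sum_(j < n)
        (k.+1%:R * hip h (hb j) * (x.1 (j, k))%:R) *:
          pbwvec ((x.1 `\ (j, k))%mset, x.2)
    | Negz k => \sum_(i < n) h 0 i *: pbwvec (((i, k) +` x.1)%mset, x.2)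
    end).

Definition eop (a : lvec L) : VL -> VL :=
  linext (fun x => (eps a x.2)%:~R *: pbwvec (x.1, a + x.2)).

(* The coefficient of z^j in (sum_(m > 0) X_m z^m)^k / in exp of this series *)
Fixpoint pow_coef (X : nat -> VL -> VL) (k j : nat) (v : VL) : VL :=
  match k with
  | 0 => if j == 0%N then v else 0
  | k'.+1 => \sum_(m < j) X m.+1 (pow_coef X k' (j - m.+1)%N v)
  end.

Definition exp_coef (X : nat -> VL -> VL) (j : nat) (v : VL) : VL :=
  \sum_(k < j.+1) (k`!%:R)^-1 *: pow_coef X k j v.

Definition expminus (a : lvec L) : nat -> VL -> VL :=
  exp_coef (fun m v => m%:R^-1 *: hmode (hvec_of a) (- m%:Z) v).

Definition expplus (a : lvec L) : nat -> VL -> VL :=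
  exp_coef (fun m v => - (m%:R^-1 *: hmode (hvec_of a) m%:Z v)).

(* A field A(z) = sum_N A_N z^(-N-1) is given by its modes A_N.  All the sums
   \sum_(i \in _) below have finite support. *)
Definition vfield := int -> VL -> VL.

(* Y(e^a, z): the exponent of z is p.1 from expminus, - p.2 from expplus, and
   (a|c) from z^a on M(1, c). *)
Definition Yexp (a : lvec L) : vfield := fun N =>
  linext (fun x =>
    \sum_(p \in [set p : nat * nat |
                   p.1%:Z - p.2%:Z + lipz a x.2 = - N - 1])
      expminus a p.1 (expplus a p.2 (eop a (pbwvec x)))).

(* The normally ordered product of (1/k!) d^k h(z) and A(z): the modes h(m)
   with m < 0 are put to the left of A(z), those with m >= 0 to the right.
   In (1/k!) d^k h(z), the coefficient of h(-p-1) is 'C(p, k) z^(p-k) and that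
   of h(p) is (-1)^k 'C(p+k, k) z^(-p-k-1). *)
Definition nop (h : hvec) (k : nat) (A : vfield) : vfield := fun N v =>
  \sum_(p \in [set: nat])
     'C(p, k)%:R *: hmode h (Negz p) (A (N + p%:Z - k%:Z) v)
  + \sum_(p \in [set: nat])
     ((-1) ^+ k * 'C((p + k)%N, k)%:R) *:
        A (N - p%:Z - k%:Z - 1) (hmode h (Posz p) v).

Definition Ypbw (x : pbw) : vfield :=
  foldr (fun ik A => nop (hb ik.1) ik.2 A) (Yexp x.2) (enum_mset x.1).

(* nprod u N v is the product u_N v, where Y(u, z) = sum_N u_N z^(-N-1). *)
Definition nprod (u : VL) (N : int) (v : VL) : VL :=
  \sum_(x <- msupp u) u@_x *: Ypbw x N v.

Definition pbw_weight (x : pbw) : R :=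
  (\sum_(ik <- enum_mset x.1) ik.2.+1)%N%:R + lip x.2 x.2 / 2.

Definition weight_one (W : set VL) : set VL :=
  W `&` [set v | forall x, x \in msupp v -> pbw_weight x = 1].

(* One half of the sum of u_i(-1) u^i(-1) 1 over dual bases of h. *)
Definition conformal : VL :=
  let G := \matrix_(i < n, j < n) ip L (b i) (b j) in
  2^-1 *: \sum_(i < n) \sum_(j < n)
    ((invmx G) i j)%:C *: hmode (hb i) (- 1) (hmode (hb j) (- 1) vacuum).

Definition vsubspace (W : set VL) :=
  W 0 /\ forall (c : R[i]) u v, W u -> W v -> W (c *: u + v).

Definition subVOA (W : set VL) :=
  [/\ vsubspace W, W vacuum, W conformal
    & forall u v N, W u -> W v -> W (nprod u N v)].

Definition Vsub (M : set (lvec L)) : set VL :=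
  [set v | forall x, x \in msupp v -> M x.2].

Definition borel_subVOA (W : set VL) :=
  subVOA W /\ exists2 B, borel_type B & W = Vsub B.

Definition parabolic_subVOA (W : set VL) :=
  subVOA W /\ exists2 P, parabolic_type P & W = Vsub P.

Definition VL1 : set VL := weight_one setT.

Definition cartan : set VL := [set hmode h (- 1) vacuum | h in setT].

Definition lie_bracket (u v : VL) : VL := nprod u 0 v.

Definition lie_subalgebra (A : set VL) :=
  [/\ vsubspace A, A `<=` VL1
    & forall u v, A u -> A v -> A (lie_bracket u v)].

Definition linspan (S : set VL) : set VL :=
  [set v | exists (m : nat) (u : 'I_m -> VL) (c : 'I_m -> R[i]),
     (forall i, S (u i)) /\ v = \sum_(i < m) c i *: u i].

Definition lie_derived (A : set VL) : set VL :=
  linspan [set lie_bracket u v | u in A & v in A].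

Definition lie_solvable (A : set VL) :=
  exists k : nat, iter k lie_derived A `<=` [set 0].

Definition lie_borel (A : set VL) :=
  [/\ lie_subalgebra A, lie_solvable A
    & forall A', lie_subalgebra A' -> lie_solvable A' -> A `<=` A' -> A' = A].

Definition lie_parabolic (A : set VL) :=
  lie_subalgebra A /\ exists2 A', lie_borel A' & A' `<=` A.

End LatticeVOA.

Arguments lroots {R} L.
Arguments VL1 {R} L.
Arguments cartan {R} L.

(* Main.v *)
From HB Require Import structures.
Require Import Defs.
From mathcomp Require Import all_boot all_order all_algebra.
From mathcomp Require Import finmap multiset.
From mathcomp Require Import boolp classical_sets cardinality fsbigop reals.
From mathcomp Require Import complex monalg.
From mathcomp Require Import zify ring lra.

Set Implicit Arguments.
Unset Strict Implicit.
Unset Printing Implicit Defensive.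

Import Order.TTheory GRing.Theory Num.Theory.

Local Open Scope classical_set_scope.
Local Open Scope ring_scope.
Local Open Scope complex_scope.

(** A subalgebra A of the weight-one Lie algebra that contains the Cartan
    subalgebra h is the sum of h and of the root lines C e^a that it contains
    ([graded_component], [expvec_mem_of_supp]).  If A is solvable, its roots
    form a set S that is closed under addition inside the root system and
    contains no pair of opposite roots, since e^a and e^-a would generate a
    copy of sl_2, which is perfect ([lie_subalgebra_rootset]).

    Such a set lies strictly on one side of a hyperplane.  Because all roots
    have the same length, the normal vector is simply the sum g of S: roots b
    of S with (b|a) = -1 are matched, through b |-> a + b, with roots of S with
    (b|a) = 1, so that (g|a) >= (a|a) = 2 ([positive_rootset_height]).  The
    half-space (g|x) > 0, completed on the hyperplane (g|x) = 0 by the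
    lexicographic order of coordinates, is a Borel-type submonoid B that
    contains S ([borel_type_extends]), hence A is contained in (V_B)_1.

    Conversely (V_B)_1 is a solvable subalgebra.  The roots in B are again
    closed and contain no pair of opposite roots, so that they have a positive
    integral height (g'|a); brackets land in height at least 1 and the derived
    series then climbs through the heights, which are bounded because the form
    is positive-definite ([solvable_VB1]).  A Borel subalgebra is maximal among
    the solvable ones, so A = (V_B)_1.  For the parabolic inclusion, L itself
    is a submonoid of parabolic type and every subalgebra is contained in
    (V_L)_1.

    That V_M is a subVOA for a submonoid M comes from the two gradings of V_L,
    by lattice degree and by weight: every mode of a basis vector shifts both
    by a fixed amount ([shifted_Ypbw]).  The weight part also shows that the
    bracket preserves (V_L)_1. *)

(** * The integral form and the roots *)

Section LatticeForm.
Variables (R : realType) (L : evenLattice R).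
Implicit Types (a b c : lvec L) (z : int).

Lemma emb_is_zmod_morphism : zmod_morphism (@emb R L).
Proof.
move=> a b; rewrite /emb -sumrB; apply: eq_bigr => i _.
by rewrite !mxE rmorphB scalerBl.
Qed.
HB.instance Definition _ :=
  GRing.isZmodMorphism.Build (lvec L) (ambient L) (@emb R L)
    emb_is_zmod_morphism.

Lemma lipC a b : lip a b = lip b a.
Proof. by rewrite /lip hermC /= expr0 mul1r. Qed.

Lemma lipDl a b c : lip (a + b) c = lip a c + lip b c.
Proof. by rewrite /lip raddfD linearDl. Qed.

Lemma lipDr a b c : lip c (a + b) = lip c a + lip c b.
Proof. by rewrite lipC lipDl !(lipC c). Qed.

(** Polarization: 2 (a|b) = (a+b|a+b) - (a|a) - (b|b) is even,
    as a combination of even integers. *)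
Lemma lip_int a b : lip a b = (lipz a b)%:~R.
Proof.
have [ma Ea] := ip_even a; have [mb Eb] := ip_even b.
have [mc Ec] := ip_even (a + b).
have E : lip a b = (mc - ma - mb)%:~R.
  move: Ea Eb Ec; rewrite -![ip L _ _]/(lip _ _) lipDl !lipDr (lipC b a).
  rewrite !rmorphB !rmorphM /= => -> -> Ec.
  have : 2%:~R * (mc%:~R - ma%:~R - mb%:~R - lip a b) = 0 :> R.
    lra.
  lra.
by rewrite /lipz E intrKfloor.
Qed.

Lemma lipzC a b : lipz a b = lipz b a.
Proof. by rewrite /lipz lipC. Qed.

Lemma lipz_is_zmod_morphism c : zmod_morphism (@lipz R L c).
Proof.
move=> a b; apply: (@intr_inj R); rewrite rmorphB /= -!lip_int.
by rewrite /lip raddfB linearBr.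
Qed.
HB.instance Definition _ c :=
  GRing.isZmodMorphism.Build (lvec L) int (@lipz R L c)
    (lipz_is_zmod_morphism c).

Lemma lipzDr c a b : lipz c (a + b) = lipz c a + lipz c b.
Proof. exact: raddfD. Qed.

Lemma lipzNr c a : lipz c (- a) = - lipz c a.
Proof. exact: raddfN. Qed.

Lemma lipzBr c a b : lipz c (a - b) = lipz c a - lipz c b.
Proof. exact: raddfB. Qed.

Lemma lipz0r c : lipz c 0 = 0.
Proof. exact: raddf0. Qed.

Lemma lipzDl a b c : lipz (a + b) c = lipz a c + lipz b c.
Proof. by rewrite lipzC lipzDr !(lipzC c). Qed.

Lemma lipzNl a c : lipz (- a) c = - lipz a c.
Proof. by rewrite lipzC lipzNr lipzC. Qed.

Definition lipzE := (lipzDl, lipzDr, lipzNl, lipzNr).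

Lemma emb_eq0 a : (emb a == 0) = (a == 0).
Proof.
apply/eqP/eqP=> [|->]; last exact: raddf0.
move=> a0; apply/rowP => i; rewrite mxE.
have /basis_free/freeP fr := lbasisP L.
apply/eqP; rewrite -(intr_eq0 R); apply/eqP.
apply: (fr (fun j => (a 0 j)%:~R)); rewrite -[RHS]a0.
by apply: eq_bigr => j _; rewrite (tnth_nth 0).
Qed.

Lemma lipz_ge0 a : 0 <= lipz a a.
Proof.
rewrite -(ler_int R) -lip_int /lip.
have [->|a0] := eqVneq (emb a) 0; first by rewrite linear0l.
exact/ltW/neq0_dnorm_gt0.
Qed.

Lemma lipz_gt0 a : a != 0 -> 0 < lipz a a.
Proof.
rewrite -emb_eq0 => a0; rewrite -(ltr_int R) -lip_int /lip.
exact: neq0_dnorm_gt0.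
Qed.

Lemma lipz_eq0 a : lipz a a = 0 -> a = 0.
Proof. by move=> a0; apply/eqP/negPn/negP => /lipz_gt0; rewrite a0. Qed.

Lemma lipz_even a : exists m : int, lipz a a = 2 * m.
Proof.
have [m /= E] := ip_even a; exists m; apply: (@intr_inj R).
by rewrite -lip_int.
Qed.

Lemma lrootsE a : lroots L a <-> lipz a a = 2.
Proof.
rewrite /lroots /= lip_int; split=> [E|->//].
by apply: (@intr_inj R); rewrite E.
Qed.

Lemma lroots_neq0 a : lroots L a -> a != 0.
Proof. by move=> /lrootsE; apply: contra_eq_neq => ->; rewrite lipz0r. Qed.

Lemma lroots_opp a : lroots L a -> lroots L (- a).
Proof. by rewrite !lrootsE !lipzE opprK. Qed.

(** Cauchy-Schwarz for two vectors of norm 2, from (a - b|a - b) >= 0. *)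
Lemma root_ip_le2 a b : lroots L a -> lroots L b ->
  lipz a b <= 2 /\ (lipz a b = 2 -> a = b).
Proof.
move=> /lrootsE ra /lrootsE rb.
have := lipz_ge0 (a - b); have := @lipz_eq0 (a - b).
rewrite !lipzE ra rb (lipzC b a) => H0 H; split; first by lia.
by move=> E; apply/eqP; rewrite -subr_eq0; apply/eqP/H0; rewrite E.
Qed.

Lemma root_addP a b : lroots L a -> lroots L b ->
  lroots L (a + b) <-> lipz a b = -1.
Proof.
move=> /lrootsE ra /lrootsE rb; rewrite lrootsE.
by rewrite !lipzE ra rb (lipzC b a); split; lia.
Qed.

(** Cauchy-Schwarz again: 2 (g|a) <= (g|g) + (a|a) is enough. *)
Lemma root_height_bound (g : lvec L) : exists K : nat, forall a,
  lroots L a -> lipz g a < K%:Z.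
Proof.
exists `|(lipz g g + 3 : int)|%N => a /lrootsE ra.
have := lipz_ge0 (g - a); rewrite !lipzE ra (lipzC a g).
have := lipz_ge0 g; lia.
Qed.

(** Reduction modulo 3 is injective on the roots: the difference of two roots
    has norm at most 8, whereas a nonzero vector of 3L has norm at least 9. *)
Lemma finite_lroots : finite_set (lroots L).
Proof.
pose red (a : lvec L) : 'rV['F_3]_(rk L) := map_mx intr a.
have red_inj : {in lroots L &, injective red}.
  move=> a b; rewrite !inE => ra rb E.
  have [c Ec] : exists c : lvec L, a - b = c *+ 3.
    exists (\row_i (((a - b) 0%R i) %/ 3)%Z); apply/rowP => i.
    rewrite mulmxnE [in RHS]mxE -[RHS]mulr_natr natz divzK//.
    move/rowP: E => /(_ i); rewrite /red !mxE => /eqP.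
    by rewrite -subr_eq0 -rmorphB /= -(dvdz_pcharf (pchar_Fp _)).
  apply/eqP; rewrite -subr_eq0 Ec; suff -> : c = 0 by rewrite mul0rn.
  apply: lipz_eq0.
  have := lipz_ge0 (a + b); have := lipz_ge0 c.
  have : lipz (a - b) (a - b) = lipz (c *+ 3) (c *+ 3) by rewrite Ec.
  rewrite !mulrSr mulr0n add0r !lipzE.
  move/lrootsE: ra => ->; move/lrootsE: rb => ->; rewrite (lipzC b a).
  lia.
have := inj_card_eq red_inj.
move=> /card_eqPle[_]; move/card_le_finite; apply.
exact: finite_finset.
Qed.

End LatticeForm.

(** * Closed sets of roots without opposite pairs *)

Section PositiveSystems.
Variables (R : realType) (L : evenLattice R).
Implicit Types (a b c g : lvec L) (S B : set (lvec L)).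

Definition positive_rootset S :=
  [/\ S `<=` lroots L,
      forall a b, S a -> S b -> lroots L (a + b) -> S (a + b)
    & forall a, S a -> ~ S (- a)].

(** The sum of S is a height.  Pairings of distinct, non-opposite roots take
    the values -1, 0, 1, and b |-> b + a maps the roots of S that pair to -1
    with a injectively to those that pair to 1, so that the contribution
    (a|a) = 2 of a itself is not compensated. *)
Lemma positive_rootset_height S : positive_rootset S ->
  exists g, forall a, S a -> 0 < lipz g a.
Proof.
case=> SPhi Sadd Santi.
have /finite_seqP[s0 Es0] := sub_finite_set SPhi (finite_lroots L).
pose s := undup s0; have sP a : (a \in s) <-> S a by rewrite mem_undup Es0.
exists (\sum_(b <- s) b) => a Sa.
have -> : lipz (\sum_(b <- s) b) a = \sum_(b <- s) lipz b a.
  by rewrite lipzC raddf_sum /=; apply: eq_bigr => b _; rewrite lipzC.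
have rooteq b : b \in s ->
    lipz b a = (2 * (b == a)%:Z + (lipz b a == 1)%:Z - (lipz b a == -1)%:Z).
  move=> /sP Sb; have ra := SPhi _ Sa; have rb := SPhi _ Sb.
  have [le2 eq2] := root_ip_le2 rb ra.
  have [leN2 eqN2] := root_ip_le2 rb (lroots_opp ra).
  rewrite lipzNr in leN2 eqN2.
  have neqN : lipz b a != -2.
    apply/eqP => E; apply: (Santi _ Sa); rewrite -eqN2 ?E//.
  have [ba|ba] := eqVneq b a.
    by rewrite ba; move/lrootsE: ra => ->.
  have : lipz b a != 2 by apply: contra ba => /eqP/eq2/eqP.
  case: eqP => [->//|]; case: eqP => [->//|]; lia.
rewrite (eq_big_seq _ rooteq) !big_split /= sumrN -mulr_sumr.
have sumE (P : pred (lvec L)) : \sum_(b <- s) (P b)%:Z = (count P s)%:Z.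
  rewrite -sum1_count -natz natr_sum [RHS]big_mkcond /=.
  by apply: eq_bigr => b _; case: (P b).
rewrite !sumE.
have sa : a \in s by apply/sP.
rewrite count_uniq_mem ?undup_uniq// sa.
suff : leq (count (fun b => lipz b a == -1) s) (count (fun b => lipz b a == 1) s).
  have arith (p q : nat) : (p <= q)%N -> 0 < 2 * 1%:Z + q%:Z - p%:Z by lia.
  exact: arith.
rewrite -!size_filter -(size_map (fun b => b + a)); apply: uniq_leq_size.
  by rewrite map_inj_uniq ?filter_uniq ?undup_uniq//; exact: addIr.
move=> x /mapP[b]; rewrite mem_filter => /andP[/eqP ba /sP Sb] {x}->.
rewrite mem_filter.
have ra := SPhi _ Sa; have rb := SPhi _ Sb.
rewrite lipzDl ba; move/lrootsE: (ra) => ->; rewrite /=.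
by apply/sP/Sadd => //; apply/root_addP.
Qed.

(** Any total order of the group Z^n would do; it serves to break the ties on
    the hyperplane orthogonal to g. *)
Definition lex_nonneg n (x : 'rV[int]_n) :=
  x = 0 \/ exists i : 'I_n, (forall j : 'I_n, (j < i)%N -> x 0 j = 0) /\ 0 < x 0 i.

Lemma lex_nonnegD n (x y : 'rV[int]_n) :
  lex_nonneg x -> lex_nonneg y -> lex_nonneg (x + y).
Proof.
move=> [->|[i [xi0 xi]]]; first by rewrite add0r.
case=> [->|[j [yj0 yj]]]; first by rewrite addr0; right; exists i.
right; have [ij|ji|ij] := ltngtP i j.
- exists i; split=> [l li|]; last by rewrite mxE yj0 ?addr0.
  by rewrite mxE xi0// yj0 ?addr0// (ltn_trans li ij).
- exists j; split=> [l lj|]; last by rewrite mxE xi0 ?add0r.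
  by rewrite mxE yj0// xi0 ?addr0// (ltn_trans lj ji).
- exists i; split=> [l li|]; first by rewrite mxE xi0 ?yj0 ?addr0 -?ij.
  by rewrite mxE addr_gt0// (_ : i = j)//; apply: val_inj.
Qed.

Lemma lex_nonneg_total n (x : 'rV[int]_n) : lex_nonneg x \/ lex_nonneg (- x).
Proof.
have [->|x0] := eqVneq x 0; first by left; left.
have [i0 xi0] : exists i, x 0 i != 0.
  apply/existsP; apply: contraNT x0; rewrite negb_exists => /forallP x0.
  by apply/eqP/rowP => i; rewrite mxE; apply/eqP; rewrite -[_ == _]negbK.
pose i := [arg min_(i < i0 | x 0%R i != 0%R) (i : nat)]%N.
have [xi mini] : x 0 i != 0 /\ forall j : 'I_n, (j < i)%N -> x 0 j = 0.
  rewrite /i; case: arg_minnP => // l xl ml; split=> // j jl.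
  by apply/eqP; apply: contraTT jl => /ml; rewrite -leqNgt.
have [xi_lt|xi_gt|/eqP] := ltgtP (x 0 i) 0; last by rewrite (negPf xi).
- right; right; exists i; split=> [j ji|]; rewrite mxE ?oppr_gt0//.
  by rewrite mini ?oppr0.
- by left; right; exists i.
Qed.

Lemma lex_nonneg_anti n (x : 'rV[int]_n) :
  lex_nonneg x -> lex_nonneg (- x) -> x = 0.
Proof.
move=> [//|[i [xi0 xi]]] [/eqP|[j [xj0]]].
  by rewrite oppr_eq0 => /eqP.
rewrite mxE oppr_gt0; have [ij|ji|/val_inj<-] := ltngtP i j.
- by have := xj0 _ ij; rewrite mxE => /eqP; rewrite oppr_eq0 (gt_eqF xi).
- by rewrite (xi0 _ ji) ltxx.
- by move=> /(lt_trans xi); rewrite ltxx.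
Qed.

(** The order by (g|x), refined lexicographically, is total. *)
Lemma borel_type_extends g : g != 0 ->
  exists2 B, borel_type B & forall a, 0 < lipz g a -> B a.
Proof.
move=> g0.
exists [set a | 0 < lipz g a \/ lipz g a = 0 /\ lex_nonneg a]; last by left.
split.
- split=> [|a b /=]; first by right; rewrite lipz0r; split=> //; left.
  rewrite lipzDr => -[ga|[ga la]] [gb|[gb lb]]; rewrite ?ga ?gb.
  + by left; apply: addr_gt0.
  + by left; rewrite addr0.
  + by left; rewrite add0r.
  + by right; split=> //; apply: lex_nonnegD.
- apply/seteqP; split=> // a _ /=.
  have [ga|ga|ga] := ltgtP (lipz g a) 0.
  + by right; exists (- a); rewrite ?opprK //= lipzNr oppr_gt0; left.
  + by left; left.
  + case: (lex_nonneg_total a) => la; first by left; right.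
    by right; exists (- a); rewrite ?opprK //= lipzNr ga oppr0; right.
- apply/seteqP; split=> [a [] /=|_ ->].
    move=> Ba [b Bb]; move: Ba => /[swap] <- {a}; rewrite lipzNr oppr_gt0.
    case: Bb => [|[->]]; first by case=> ? [|[]]; lia.
    move=> lb [|[_ lb']]; first by rewrite ltxx.
    by rewrite (lex_nonneg_anti lb lb') oppr0.
  split; first by right; rewrite lipz0r; split=> //; left.
  exists 0; rewrite ?oppr0//.
  by right; rewrite lipz0r; split=> //; left.
- exists (emb g); first by rewrite emb_eq0.
  move=> a /=; rewrite -[ip L _ _]/(lip g a) lip_int ler0z.
  by case=> [/ltW|[-> _]].
Qed.

Lemma borel_type_roots B : borel_type B ->
  positive_rootset (B `&` lroots L).
Proof.
case=> -[B0 BD] _ Banti _; split=> [a []//|a b [Ba _] [Bb _] rab|a [Ba ra] [Ba' _]].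
  by split=> //; apply: BD.
have : (B `&` [set - x | x in B]) a.
  by split=> //; exists (- a); rewrite ?opprK.
by rewrite Banti /= => /eqP; rewrite (negPf (lroots_neq0 ra)).
Qed.

End PositiveSystems.

(** * The gradings by lattice degree and by weight *)

Section Gradings.
Variables (R : realType) (L : evenLattice R).
Variable eps : lvec L -> lvec L -> int.
Implicit Types (a c : lvec L) (d : R) (u v w : VL L) (x y z : pbw L).

Local Notation wt := (@pbw_weight R L).

Lemma linext_is_linear (f : pbw L -> VL L) : linear (linext f).
Proof.
move=> k u v; rewrite /linext.
pose D := (msupp u `|` msupp v)%fset.
have sumE (w : VL L) : {subset msupp w <= D} ->
    \sum_(x <- msupp w) w@_x *: f x = \sum_(x <- D) w@_x *: f x.
  move=> sub; apply: big_fset_incl => [|x _ /mcoeff_outdom ->]; last by rewrite scale0r.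
  exact/fsubsetP.
rewrite !sumE.
- rewrite scaler_sumr -big_split; apply: eq_bigr => x _.
  by rewrite mcoeffD mcoeffZ scalerDl scalerA.
- by move=> x xv; rewrite in_fsetE xv orbT.
- by move=> x xu; rewrite in_fsetE xu.
- move=> x /(fsubsetP (msuppD_le _ _)); rewrite !in_fsetE.
  by case/orP=> [/(fsubsetP (msuppZ_le _ _))->|->]; rewrite ?orbT.
Qed.
HB.instance Definition _ f :=
  GRing.isLinear.Build R[i] (VL L) (VL L) _ (linext f) (linext_is_linear f).
HB.instance Definition _ h m := GRing.Linear.copy (@hmode R L h m) (linext _).
HB.instance Definition _ a := GRing.Linear.copy (eop eps a) (linext _).
HB.instance Definition _ a N := GRing.Linear.copy (Yexp eps a N) (linext _).

Lemma msupp_pbwvec x : msupp (pbwvec x) = [fset x]%fset.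
Proof. by rewrite msuppU oner_eq0. Qed.

Lemma mcoeff_pbwvec x y : (pbwvec x)@_y = (x == y)%:R.
Proof. exact: mcoeffU. Qed.

Lemma mem_pbwvec x y : y \in msupp (pbwvec x) -> y = x.
Proof. by rewrite msupp_pbwvec inE => /eqP. Qed.

Lemma pbwvec_mem x : x \in msupp (pbwvec x).
Proof. by rewrite msupp_pbwvec inE. Qed.

Lemma linext_pbwvec (f : pbw L -> VL L) x : linext f (pbwvec x) = f x.
Proof. by rewrite /linext msupp_pbwvec big_seq_fset1 mcoeffUU scale1r. Qed.

Lemma pbw_decomp v : v = \sum_(x <- msupp v) v@_x *: pbwvec x.
Proof.
rewrite {1}(monalgE v); apply: eq_bigr => x _; apply/malgP => y.
rewrite mcoeffU.
rewrite [RHS]mcoeffZ.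
rewrite mcoeff_pbwvec.
by case: eqP => _; rewrite ?mulr1n ?mulr0n ?mulr1 ?mulr0.
Qed.

(** Stated for the supports of a vector v and of its image w, rather than for
    homogeneous vectors, so that it composes and adds up without decomposing v
    and without knowing that the operator is linear. *)
Definition shifted c d v w := forall x, x \in msupp w ->
  exists2 y, y \in msupp v & x.2 = y.2 + c /\ wt x = wt y + d.

Lemma shifted0 c d v : shifted c d v 0.
Proof. by move=> x; rewrite msupp0. Qed.

Lemma shiftedD c d v w w' : shifted c d v w -> shifted c d v w' ->
  shifted c d v (w + w').
Proof.
by move=> Hw Hw' x /(fsubsetP (msuppD_le _ _)); rewrite in_fsetE => /orP[/Hw|/Hw'].
Qed.

Lemma shiftedZ c d v w (k : R[i]) : shifted c d v w -> shifted c d v (k *: w).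
Proof. by move=> Hw x /(fsubsetP (msuppZ_le _ _)) /Hw. Qed.

Lemma shifted_sum c d v (I : eqType) (s : seq I) (F : I -> VL L) :
  (forall i, i \in s -> shifted c d v (F i)) ->
  shifted c d v (\sum_(i <- s) F i).
Proof.
move=> HF; rewrite big_seq; elim/big_ind: _ => //; first exact: shifted0.
by move=> *; exact: shiftedD.
Qed.

Lemma shifted_fsum c d v (I : choiceType) (A : set I) (F : I -> VL L) :
  (forall i, A i -> shifted c d v (F i)) ->
  shifted c d v (\sum_(i \in A) F i).
Proof.
move=> HF; apply: shifted_sum => i; case: finite_supportP => //= X XA _ _.
by move=> /XA; exact: HF.
Qed.

Lemma shifted_trans c d c' d' c2 d2 u v w : shifted c d u v ->
  shifted c' d' v w -> c + c' = c2 -> d + d' = d2 -> shifted c2 d2 u w.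
Proof.
move=> uv vw <- <- x /vw[y /uv[z zu [-> ->]] [-> ->]]; exists z => //.
by rewrite !addrA.
Qed.

Lemma shifted_linext f c d v :
  (forall y, y \in msupp v -> shifted c d (pbwvec y) (f y)) ->
  shifted c d v (linext f v).
Proof.
move=> Hf; apply: shifted_sum => y yv; apply: shiftedZ => x /(Hf _ yv)[z].
by move=> /mem_pbwvec -> xy; exists y.
Qed.

Lemma shifted_pbwvec c d x y : x.2 = y.2 + c -> wt x = wt y + d ->
  shifted c d (pbwvec y) (pbwvec x).
Proof.
by move=> xy2 xyw z /mem_pbwvec ->; exists y; [exact: pbwvec_mem | split].
Qed.

Lemma wt_mset1D (ik : 'I_(rk L) * nat) (X : {mset 'I_(rk L) * nat}%mset) a :
  wt ((ik +` X)%mset, a) = wt (X, a) + ik.2.+1%:R.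
Proof.
have sumE : (\sum_(jk <- enum_mset (ik +` X)%mset) jk.2.+1 =
    ik.2.+1 + \sum_(jk <- enum_mset X) jk.2.+1)%N.
  rewrite -(big_cons _ _ ik (enum_mset X) xpredT (fun jk => jk.2.+1)).
  apply: perm_big; apply/allP => jk _ /=.
  by rewrite !count_mem_mset mset1DE [ik == jk]eq_sym.
rewrite /pbw_weight; cbn [fst snd].
rewrite sumE natrD.
by rewrite [_%:R + _]addrC addrAC.
Qed.

Lemma shifted_hmode h (m : int) v : shifted 0 (- m%:~R) v (hmode h m v).
Proof.
apply: shifted_linext => -[X a] _; case: m => [[|k]|k].
- by apply/shiftedZ/shifted_pbwvec; rewrite ?addr0 //= oppr0 addr0.
- apply: shifted_sum => j _.
  have [jX|jX] := boolP ((j, k) \in (X : {mset 'I_(rk L) * nat}%mset)); last first.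
    by rewrite (mset_eq0P jX) mulr0 scale0r; exact: shifted0.
  apply/shiftedZ/shifted_pbwvec; rewrite ?addr0 //=.
  by rewrite -[in RHS](msetB1K jX) wt_mset1D /= -pmulrn; ring.
- apply: shifted_sum => i _; apply/shiftedZ/shifted_pbwvec; rewrite ?addr0 //.
  by rewrite wt_mset1D NegzE /= mulrNz opprK -pmulrn.
Qed.

(* The sign s is 1 for creation and -1 for annihilation operators. *)
Section Exponentials.
Variables (X : nat -> VL L -> VL L) (s : R).
Hypothesis XP : forall m v, shifted 0 (s * m%:R) v (X m v).

Lemma shifted_pow_coef k j v : shifted 0 (s * j%:R) v (pow_coef X k j v).
Proof.
elim: k j => [|k IHk] j /=.
  have [->|_] := eqVneq j 0%N; last exact: shifted0.
  by move=> x xv; exists x; rewrite ?mulr0 ?addr0.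
apply: shifted_sum => m _.
apply: (shifted_trans (@IHk _) (@XP _ _)); first exact: addr0.
by rewrite -mulrDr -natrD subnK.
Qed.

Lemma shifted_exp_coef j v : shifted 0 (s * j%:R) v (exp_coef X j v).
Proof.
by apply: shifted_sum => k _; apply: shiftedZ; exact: shifted_pow_coef.
Qed.

End Exponentials.

Lemma shifted_expminus a j v : shifted 0 j%:R v (expminus a j v).
Proof.
rewrite -[j%:R]mul1r; apply: shifted_exp_coef => m w; apply: shiftedZ.
by have := @shifted_hmode (hvec_of a) (- m%:Z) w; rewrite mulrNz opprK mul1r.
Qed.

Lemma shifted_expplus a j v : shifted 0 (- j%:R) v (expplus a j v).
Proof.
rewrite -mulN1r; apply: shifted_exp_coef => m w.
rewrite -scaleNr; apply: shiftedZ; rewrite mulN1r.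
exact: (@shifted_hmode _ m).
Qed.

Lemma shifted_eop a y :
  shifted a (lip a a / 2 + lip a y.2) (pbwvec y) (eop eps a (pbwvec y)).
Proof.
rewrite /eop linext_pbwvec; apply/shiftedZ/shifted_pbwvec; first exact: addrC.
rewrite /pbw_weight /= lipDl !lipDr (lipC y.2 a); lra.
Qed.

(** The factor z^a contributes (a|c) to the exponent of z, which is exactly the
    cross term in the norm of a + c; hence the shift does not depend on the
    degree c of the argument. *)
Lemma shifted_Yexp a N v :
  shifted a (lip a a / 2 - N%:~R - 1) v (Yexp eps a N v).
Proof.
apply: shifted_linext => y _; apply: shifted_fsum => -[p q] /= pq.
apply: (shifted_trans (c := a) (c' := 0) _ (@shifted_expminus _ _ _)).
- apply: (shifted_trans (@shifted_eop _ _) (@shifted_expplus _ _ _)) => //.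
  exact: addr0.
- exact: addr0.
- have := congr1 (fun n : int => n%:~R : R) pq.
  rewrite /= [lip a y.2]lip_int !rmorphD !rmorphN /= => E; lra.
Qed.

(** In the mode N of the normally ordered product, the modes of h(z) and A(z)
    always add up to the same index, so each term has the same shift. *)
Lemma shifted_nop h k (A : vfield L) c d :
  (forall N v, shifted c (d - N%:~R - 1) v (A N v)) ->
  forall N v, shifted c (k.+1%:R + d - N%:~R - 1) v (nop h k A N v).
Proof.
move=> HA N v; apply: shiftedD; apply: shifted_fsum => p _; apply: shiftedZ.
- apply: (shifted_trans (@HA _ _) (@shifted_hmode _ _ _)); first exact: addr0.
  rewrite NegzE !rmorphD !rmorphN /= -!pmulrn; lra.
- apply: (shifted_trans (@shifted_hmode _ _ _) (@HA _ _)); first exact: add0r.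
  rewrite !rmorphD !rmorphN /= -!pmulrn; lra.
Qed.

Lemma shifted_Ypbw x N v :
  shifted x.2 (wt x - N%:~R - 1) v (Ypbw eps x N v).
Proof.
case: x => X a; rewrite /Ypbw /pbw_weight /=.
elim: (enum_mset X) N v => [|[i k] s IHs] N v /=.
  by rewrite big_nil add0r; exact: shifted_Yexp.
rewrite big_cons natrD -(addrA k.+1%:R).
apply: (@shifted_nop (hb i) k _ a); exact: IHs.
Qed.

Lemma msupp_nprod_term u N v x : x \in msupp (nprod eps u N v) ->
  exists2 y, y \in msupp u & x \in msupp (Ypbw eps y N v).
Proof.
rewrite /nprod big_seq; elim/big_ind: _ => [|w w' IHw IHw'|y yu].
- by rewrite msupp0.
- by move=> /(fsubsetP (msuppD_le _ _)); rewrite in_fsetE => /orP[/IHw|/IHw'].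
- by move=> /(fsubsetP (msuppZ_le _ _)) ?; exists y.
Qed.

Lemma msupp_nprod u N v x : x \in msupp (nprod eps u N v) ->
  exists y z, [/\ y \in msupp u, z \in msupp v, x.2 = z.2 + y.2
                & wt x = wt z + (wt y - N%:~R - 1)].
Proof.
by move=> /msupp_nprod_term[y yu /shifted_Ypbw[z zv [? ?]]]; exists y, z.
Qed.

Lemma Vsub_vsubspace (M : set (lvec L)) : vsubspace (Vsub M).
Proof.
split=> [x|k u v Mu Mv x]; first by rewrite msupp0.
move=> /(fsubsetP (msuppD_le _ _)); rewrite in_fsetE => /orP[|/Mv//].
by move=> /(fsubsetP (msuppZ_le _ _)) /Mu.
Qed.

Lemma Vsub_subVOA (M : set (lvec L)) : submonoid M -> subVOA eps (Vsub M).
Proof.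
case=> M0 MD; split.
- exact: Vsub_vsubspace.
- by move=> x /mem_pbwvec ->.
- have : shifted 0 2 (vacuum L) (conformal L).
    apply: shiftedZ; apply: shifted_sum => i _; apply: shifted_sum => j _.
    apply: shiftedZ.
    have E v h : shifted 0 1 v (hmode h (-1) v).
      by have := @shifted_hmode h (-1) v; rewrite mulrNz opprK.
    by apply: (shifted_trans (@E _ _) (@E _ _)); rewrite ?addr0.
  by move=> cP x /cP[y /mem_pbwvec -> [-> _]]; rewrite addr0.
- move=> u v N Mu Mv x /msupp_nprod[y [z [/Mu My /Mv Mz -> _]]].
  exact: MD.
Qed.

End Gradings.

(** * Brackets in weight one *)

Section Brackets.
Variables (R : realType) (L : evenLattice R).
Variable eps : lvec L -> lvec L -> int.
Hypothesis heps : cocycle eps.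
Implicit Types (a b : lvec L) (h : hvec L) (u v w : VL L) (x y z : pbw L).

Local Notation bracket := (lie_bracket eps).

Lemma nprodE u N v : nprod eps u N v = linext (fun x => Ypbw eps x N v) u.
Proof. by []. Qed.

Lemma hip_of a b : hip (hvec_of a) (hvec_of b) = (lip a b)%:C.
Proof.
rewrite /lip [X in ip L X _]/emb linear_sumlz rmorph_sum; apply: eq_bigr => i _.
rewrite linear_sumr rmorph_sum; apply: eq_bigr => j _.
by rewrite linearZl_LR linearZr_LR /= !mxE !rmorphM /= !rmorph_int mulrA.
Qed.

Lemma hipE h h' : hip h h' = \sum_(i < rk L) h 0 i * hip (hb i) h'.
Proof.
apply: eq_bigr => i _; rewrite [in RHS]/hip [in RHS](bigD1 i)//=.
rewrite [X in _ * (_ + X)]big1 => [|l li]; last first.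
  apply: big1 => j _.
  by rewrite mxE /= (negPf li) !mul0r.
rewrite addr0 mulr_sumr; apply: eq_bigr => j _.
by rewrite [in RHS]mxE !eqxx mul1r mulrA.
Qed.

Lemma mcoeff_linext (f : pbw L -> VL L) v x :
  (linext f v)@_x = \sum_(y <- msupp v) v@_y * (f y)@_x.
Proof. by rewrite raddf_sum; apply: eq_bigr => y _; exact: mcoeffZ. Qed.

Lemma mcoeff_hmode0 h v x : (hmode h 0 v)@_x = hip h (hvec_of x.2) * v@_x.
Proof.
have vE : v@_x = \sum_(y <- msupp v) v@_y * (pbwvec y)@_x.
  by rewrite -mcoeff_linext -[linext _ _](pbw_decomp v).
rewrite mcoeff_linext vE mulr_sumr; apply: eq_bigr => y _.
rewrite [(_ *: _)@_x]mcoeffZ mcoeff_pbwvec.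
by have [->|_] := eqVneq y x; rewrite ?mulr0// mulrCA.
Qed.

Lemma exp_coef_vanish (X : nat -> VL L -> VL L) v j :
  (forall m, X m.+1 v = 0) -> (forall m, X m.+1 0 = 0) ->
  exp_coef X j v = if j == 0%N then v else 0.
Proof.
move=> Xv X0.
have powS k i :
    pow_coef X k.+1 i v = \sum_(m < i) X m.+1 (pow_coef X k (i - m.+1)%N v).
  by [].
have powE k i : pow_coef X k.+1 i v = 0.
  elim: k i => [|k IHk] i; rewrite powS big1// => m _; last by rewrite IHk.
  by rewrite /=; case: ifP.
rewrite /exp_coef big_ord_recl big1 => [|k _]; last first.
  by rewrite lift0 powE scaler0.
by rewrite addr0 /= invr1 scale1r.
Qed.

Lemma exp_coef_zero (X : nat -> VL L -> VL L) j :
  (forall m, X m.+1 0 = 0) -> exp_coef X j 0 = 0.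
Proof. by move=> X0; rewrite exp_coef_vanish//; case: ifP. Qed.

Lemma hvec_of0 : hvec_of (0 : lvec L) = 0.
Proof. exact: raddf0. Qed.

Lemma hmode_cst0 m v : hmode (0 : hvec L) m v = 0.
Proof.
have hip0 h : hip (0 : hvec L) h = 0.
  by rewrite hipE big1// => i _; rewrite mxE mul0r.
apply: big1 => x _; case: m => [[|k]|k]; rewrite ?hip0 ?scale0r ?scaler0//.
  by rewrite big1 ?scaler0// => j _; rewrite hip0 mulr0 mul0r scale0r.
by rewrite big1 ?scaler0// => j _; rewrite mxE scale0r.
Qed.

Lemma expplus_expvec a b (k : R[i]) j :
  expplus a j (k *: expvec b) = if j == 0%N then k *: expvec b else 0.
Proof.
apply: exp_coef_vanish => m; last by rewrite linear0 scaler0 oppr0.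
rewrite [hmode _ _ (_ *: _)]linearZ /= [hmode _ _ (expvec _)]linext_pbwvec.
rewrite big1 ?scaler0 ?oppr0// => i _.
by rewrite mset0E mulr0 scale0r.
Qed.

Lemma expminus1 a v : expminus a 1 v = hmode (hvec_of a) (-1) v.
Proof.
rewrite /expminus /exp_coef !big_ord_recl big_ord0 /= !big_ord_recl !big_ord0 /=.
by rewrite scaler0 add0r addr0 !invr1 !scale1r addr0.
Qed.

Lemma expminus0 a v : expminus a 0 v = v.
Proof. by rewrite /expminus /exp_coef big_ord1 /= invr1 scale1r. Qed.

Lemma fsum_single (I : choiceType) (A : set I) (F : I -> VL L) i0 :
  A i0 -> (forall i, A i -> i != i0 -> F i = 0) -> \sum_(i \in A) F i = F i0.
Proof.
move=> Ai0 F0; rewrite (fsbigE [:: i0])//; first by rewrite big_mkcond big_seq1 mem_set.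
  by move=> i /=; rewrite inE => /eqP ->.
by move=> i Ai; rewrite inE; exact: F0.
Qed.

(** The vacuum axiom Y(1, z) = id. *)
Lemma Yexp0 N v : Yexp eps 0 N v = if N == -1 then v else 0.
Proof.
have minus0 j w : expminus (0 : lvec L) j w = if j == 0%N then w else 0.
  by apply: exp_coef_vanish => m; rewrite hvec_of0 hmode_cst0 scaler0.
have plus0 j w : expplus (0 : lvec L) j w = if j == 0%N then w else 0.
  by apply: exp_coef_vanish => m; rewrite hvec_of0 hmode_cst0 scaler0 oppr0.
have termE p q x : expminus (0 : lvec L) p (expplus 0 q (eop eps 0 (pbwvec x)))
    = if (p == 0%N) && (q == 0%N) then pbwvec x else 0.
  rewrite minus0 plus0; case: (p == 0%N) => //=; case: (q == 0%N) => //.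
  rewrite [eop _ _ _]linext_pbwvec.
  have [_ _ _ /(_ x.2)[-> _]] := heps.
  by rewrite scale1r add0r; case: x.
have l0 a : lipz 0 a = 0 by rewrite lipzC lipz0r.
have [->|N1] := eqVneq N (-1).
  rewrite [RHS]pbw_decomp; apply: eq_bigr => x _; congr (_ *: _).
  have zz : [set p : nat * nat | p.1%:Z - p.2%:Z + lipz 0 x.2 = - -1 - 1] (0%N, 0%N).
    by rewrite /= l0.
  rewrite (fsum_single zz) => [|[p q] _]; first exact: termE.
  by rewrite termE xpair_eqE => /negPf ->.
rewrite /Yexp /linext big1 => // x _.
suff -> : \sum_(p \in [set p : nat * nat |
    p.1%:Z - p.2%:Z + lipz 0 x.2 = - N - 1])
  expminus (0 : lvec L) p.1 (expplus 0 p.2 (eop eps 0 (pbwvec x))) = 0.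
  exact: scaler0.
apply: fsbig1 => -[p q] /=; rewrite l0 termE => E.
case: ifP => // /andP[/eqP p0 /eqP q0]; case/eqP: N1.
by rewrite p0 q0 in E; lia.
Qed.

Lemma Ypbw_cartan i v :
  Ypbw eps ([mset (i, 0%N)]%mset, 0) 0 v = hmode (hb i) 0 v.
Proof.
have -> : Ypbw eps ([mset (i, 0%N)]%mset, 0) = nop (hb i) 0 (Yexp eps 0).
  by rewrite /Ypbw [enum_mset _]enum_msetn.
have Yexp0_neq N w : N != -1 -> Yexp eps 0 N w = 0.
  by move=> N1; rewrite Yexp0 (negPf N1).
rewrite /nop -[RHS]add0r; congr (_ + _).
  apply: fsbig1 => p _; rewrite Yexp0_neq; last by apply/eqP; lia.
  by rewrite [hmode _ _ _]linear0 scaler0.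
have T0 : [set: nat] 0%N by [].
rewrite (fsum_single T0) => [|p _ p0].
  by rewrite Yexp0 bin0 expr0 mulr1 scale1r.
rewrite Yexp0_neq; first exact: scaler0.
by apply/eqP; lia.
Qed.

Lemma cartan_vecE h :
  hmode h (-1) (vacuum L) = \sum_(i < rk L) h 0 i *: pbwvec ([mset (i, 0%N)]%mset, 0).
Proof.
by rewrite /hmode linext_pbwvec; apply: eq_bigr => i _; rewrite msetD0.
Qed.

(** The Cartan subalgebra acts diagonally, through the lattice degree. *)
Lemma bracket_cartan h v : bracket (hmode h (-1) (vacuum L)) v = hmode h 0 v.
Proof.
rewrite /lie_bracket nprodE cartan_vecE linear_sum /=; apply/malgP => x.
rewrite mcoeff_hmode0 hipE mulr_suml raddf_sum /=; apply: eq_bigr => i _.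
by rewrite linearZ /= linext_pbwvec Ypbw_cartan mcoeffZ mcoeff_hmode0 mulrA.
Qed.

Lemma bracket_expvec a v : bracket (expvec a) v = Yexp eps a 0 v.
Proof. by rewrite /lie_bracket nprodE linext_pbwvec /Ypbw /= enum_mset0. Qed.

(** The annihilation part fixes e^(a+b), and z^a contributes z^(a|b), so that
    the coefficient of z^-1 in Y(e^a, z) e^b is the one of z^p0, for
    p0 = -1 - (a|b), in the creation part. *)
Lemma bracket_expvec_term a b p0 : p0%:Z + lipz a b = -1 ->
  bracket (expvec a) (expvec b) =
  expminus a p0 ((eps a b)%:~R *: expvec (a + b)).
Proof.
move=> p0E; rewrite bracket_expvec /Yexp linext_pbwvec /=.
rewrite [eop _ _ _]linext_pbwvec /= -/(expvec _).
rewrite (@fsum_single _ _ _ (p0, 0%N)) /=.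
- by rewrite expplus_expvec.
- by rewrite subr0 p0E oppr0 sub0r.
- move=> [p q] /= pqE; rewrite xpair_eqE expplus_expvec => pq0.
  case: eqP => q0; last by apply: exp_coef_zero => l; rewrite linear0 scaler0.
  by case/negP: pq0; rewrite q0 eqxx andbT; apply/eqP; lia.
Qed.

Lemma eps_unit a b : (eps a b)%:~R != 0 :> R[i].
Proof. by have [/(_ a b)[->|->] _ _ _] := heps; rewrite intr_eq0. Qed.

Lemma bracket_expvec_root a b : lipz a b = -1 ->
  bracket (expvec a) (expvec b) = (eps a b)%:~R *: expvec (a + b).
Proof. by move=> ab; rewrite (@bracket_expvec_term _ _ 0%N) ?ab// expminus0. Qed.

Lemma bracket_expvec_opp a : lroots L a ->
  bracket (expvec a) (expvec (- a)) =
  (eps a (- a))%:~R *: hmode (hvec_of a) (-1) (vacuum L).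
Proof.
move=> /lrootsE ra; rewrite (@bracket_expvec_term _ _ 1%N) ?lipzNr ?ra//.
by rewrite expminus1 subrr linearZ.
Qed.

Lemma hmode0_expvec h a : hmode h 0 (expvec a) = hip h (hvec_of a) *: expvec a.
Proof. by rewrite /hmode linext_pbwvec. Qed.

End Brackets.

(** * Subalgebras containing the Cartan subalgebra *)

Section WeightOne.
Variables (R : realType) (L : evenLattice R).
Variable eps : lvec L -> lvec L -> int.
Hypothesis heps : cocycle eps.
Implicit Types (a b : lvec L) (u v w : VL L) (x y z : pbw L).
Implicit Types (A W : set (VL L)) (B S : set (lvec L)).

Local Notation wt := (@pbw_weight R L).
Local Notation bracket := (lie_bracket eps).
Local Notation coroot a := (hmode (hvec_of a) (-1) (vacuum L)).

Lemma vsubspaceZ W (k : R[i]) v : vsubspace W -> W v -> W (k *: v).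
Proof. by case=> W0 WD Wv; rewrite -[_ *: v]addr0; exact: WD. Qed.

Lemma vsubspaceZ_inv W (k : R[i]) v : vsubspace W -> k != 0 -> W (k *: v) -> W v.
Proof.
move=> Wsub k0 /(vsubspaceZ k^-1 Wsub).
by rewrite scalerA mulVf// scale1r.
Qed.

Lemma weight_one_pbw x : wt x = 1 ->
  x.2 = 0 /\ (exists i, x.1 = [mset (i, 0%N)]%mset) \/
  x.1 = mset0 /\ lroots L x.2.
Proof.
have enum_inj (X Y : {mset 'I_(rk L) * nat}%mset) :
    enum_mset X = enum_mset Y -> X = Y.
  by move=> XY; apply/msetP => ik; rewrite -!count_mem_mset XY.
case: x => X a; rewrite /pbw_weight /= => wt1.
have [m aE] := lipz_even a; have := lipz_ge0 a.
have : (\sum_(ik <- enum_mset X) ik.2.+1)%N%:Z + m = 1.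
  apply: (@intr_inj R); move: wt1; rewrite lip_int aE rmorphM rmorphD /=.
  by rewrite -pmulrn; lra.
case E: (enum_mset X) => [|[i k] s]; rewrite ?big_nil ?big_cons /=.
  move=> m1 _; right; split; last by apply/lrootsE; rewrite aE; lia.
  by apply: enum_inj; rewrite E enum_mset0.
case: s E => [|[i' k'] s] E; rewrite ?big_nil ?big_cons /= => m1 m0; last lia.
left; split; first by apply: lipz_eq0; lia.
exists i; apply: enum_inj; rewrite E enum_msetn /=.
by congr [:: (_, _)]; lia.
Qed.

(** The operators h(0) separate the degrees: composing the factors
    (h(0) - (h|b)) / ((h|a) - (h|b)) for h = a - b, over the other degrees b
    that occur in v, gives the projection to degree a. *)
Lemma graded_component W v a : vsubspace W ->
  (forall h w, W w -> W (hmode h 0 w)) -> W v ->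
  exists2 w, W w & forall x, w@_x = if x.2 == a then v@_x else 0.
Proof.
move=> Wsub Wh Wv.
have kill (s : seq (lvec L)) : a \notin s ->
    exists (f : lvec L -> R[i]) w, [/\ W w, forall x, w@_x = f x.2 * v@_x, f a = 1 &
      forall b, b \in s -> f b = 0].
  elim: s => [_|b s IHs]; first by exists (fun=> 1), v; split=> // x; rewrite mul1r.
  rewrite inE negb_or => /andP[ab /IHs[f [w [Ww wE fa fs]]]].
  (* [a - b] separates [a] from [b] as [(a - b|a - b) > 0]. *)
  pose ev c := hip (hvec_of (a - b)) (hvec_of c).
  have evE : ev a - ev b != 0.
    rewrite /ev !hip_of -rmorphB /= !lip_int -rmorphB /= -lipzBr.
    rewrite -(rmorph0 (real_complex R)) (inj_eq (@complexI R)) intr_eq0.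
    by rewrite gt_eqF// lipz_gt0// subr_eq0.
  exists (fun c => (ev a - ev b)^-1 * (ev c - ev b) * f c).
  exists ((ev a - ev b)^-1 *: (- ev b *: w + hmode (hvec_of (a - b)) 0 w)); split.
  - by apply: vsubspaceZ => //; case: Wsub => _; apply => //; exact: Wh.
  - by move=> x; rewrite mcoeffZ mcoeffD mcoeffZ mcoeff_hmode0 wE /ev; ring.
  - by rewrite fa mulVf ?mulr1.
  - move=> c; rewrite inE => /predU1P[->|/fs->]; last by rewrite mulr0.
    by rewrite subrr mulr0 mul0r.
have [|f [w [Ww wE fa fs]]] := kill [seq x.2 | x <- msupp v & x.2 != a].
  by apply/mapP => -[x]; rewrite mem_filter => /andP[/eqP xa _] /esym.
exists w => // x; rewrite wE; case: eqP => [->|/eqP xa]; first by rewrite fa mul1r.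
have [xv|/mcoeff_outdom->] := boolP (x \in msupp v); last by rewrite mulr0.
by rewrite fs ?mul0r//; apply: map_f; rewrite mem_filter xa.
Qed.

Lemma expvec_mem_of_supp A v x : lie_subalgebra eps A -> cartan L `<=` A ->
  A v -> x \in msupp v -> x.2 != 0 -> lroots L x.2 /\ A (expvec x.2).
Proof.
move=> [Asub AVL1 Abr] hA Av xv x0.
have suppE y : y \in msupp v -> y.2 != 0 -> y.1 = mset0 /\ lroots L y.2.
  have [_ /(_ y) vwt] := AVL1 _ Av.
  by move=> /vwt /weight_one_pbw[[->]|//]; rewrite eqxx.
have [x1 rx] := suppE _ xv x0; split=> //.
have Ah h w : A w -> A (hmode h 0 w).
  by move=> Aw; rewrite -(bracket_cartan heps); apply: Abr => //; apply: hA; exists h.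
have [w Aw wE] := graded_component x.2 Asub Ah Av.
apply: (@vsubspaceZ_inv _ v@_x) => //; first by rewrite mcoeff_neq0.
suff -> : v@_x *: expvec x.2 = w by [].
apply/malgP => y; rewrite mcoeffZ mcoeffU wE.
have [y2|yx] := eqVneq y.2 x.2; last first.
  by rewrite (_ : (_, _) == y = false) ?mulr0//; apply: contraNF yx => /eqP <-.
have [yv|/mcoeff_outdom y0] := boolP (y \in msupp v).
  have [y1 _] := suppE _ yv (eq_ind_r (fun t => t != 0) x0 y2).
  have -> : y = x by case: y x x1 y1 y2 {suppE xv x0 rx Aw wE yv} => [? ?] [? ?] /= -> -> ->.
  by rewrite -x1 -surjective_pairing eqxx mulr1.
rewrite y0; case: eqP => [yE|]; rewrite ?mulr0// mulr1.
by rewrite -y0 -yE -x1 -surjective_pairing.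
Qed.

Lemma lie_derived_bracket A (k : R[i]) u v : A u -> A v ->
  lie_derived eps A (k *: bracket u v).
Proof.
move=> Au Av; exists 1%N, (fun=> bracket u v), (fun=> k); split.
  by move=> _; exists u => //; exists v.
by rewrite big_ord1.
Qed.

(** The triple e^a, e^-a, a(-1)1 spans a copy of sl_2, hence stays in every
    term of the derived series. *)
Lemma opposite_roots_not_solvable A a : lie_subalgebra eps A ->
  lie_solvable eps A -> lroots L a -> A (expvec a) -> A (expvec (- a)) -> False.
Proof.
move=> [Asub _ Abr] [k solv] ra Aa ANa.
have rE : hip (hvec_of a) (hvec_of a) = 2.
  by rewrite hip_of lip_int; move/lrootsE: ra => ->; rewrite rmorph_int.
have e0 := eps_unit heps a (- a).
have sl2 j : [/\ iter j (lie_derived eps) A (expvec a),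
    iter j (lie_derived eps) A (expvec (- a))
  & iter j (lie_derived eps) A (coroot a)].
  elim: j => [|j [IHa IHNa IHh]].
    split; [exact: Aa | exact: ANa | apply: (vsubspaceZ_inv Asub e0)].
    by rewrite -(bracket_expvec_opp eps ra); exact: Abr.
  split; rewrite iterS.
  - have := lie_derived_bracket 2^-1 IHh IHa.
    by rewrite (bracket_cartan heps) hmode0_expvec rE scalerA mulVf ?pnatr_eq0// scale1r.
  - have := lie_derived_bracket (- 2^-1) IHh IHNa.
    rewrite (bracket_cartan heps) hmode0_expvec scalerA.
    have -> : hip (hvec_of a) (hvec_of (- a)) = - 2.
      by rewrite hip_of lip_int lipzNr; move/lrootsE: ra => ->; rewrite rmorph_int.
    by rewrite mulrNN mulVf ?pnatr_eq0// scale1r.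
  - have := lie_derived_bracket ((eps a (- a))%:~R^-1) IHa IHNa.
    by rewrite (bracket_expvec_opp eps ra) scalerA mulVf// scale1r.
have [/solv /= e0' _ _] := sl2 k.
have : (expvec a : VL L)@_(mset0, a) = 0 by rewrite e0' mcoeff0.
by rewrite mcoeffUU => /eqP; rewrite oner_eq0.
Qed.

Lemma lie_subalgebra_rootset A : lie_subalgebra eps A -> lie_solvable eps A ->
  positive_rootset [set a | lroots L a /\ A (expvec a)].
Proof.
move=> Alie Asolv; have [Asub _ Abr] := Alie; split=> [a []//| |].
- move=> a b [ra Aa] [rb Ab] rab; split; first exact: rab.
  have /(bracket_expvec_root eps) eq_ab : lipz a b = -1 by exact/root_addP.
  apply: (vsubspaceZ_inv Asub (eps_unit heps a b)).
  by rewrite -eq_ab; apply: Abr; [exact: Aa | exact: Ab].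
- move=> a [ra Aa] [_ ANa].
  exact: (opposite_roots_not_solvable Alie Asolv ra Aa ANa).
Qed.

Lemma lie_subalgebra_VB1 B : submonoid B ->
  lie_subalgebra eps (weight_one (Vsub B)).
Proof.
move=> Bmon; have [Bsub _ _ Bprod] := Vsub_subVOA eps Bmon.
split=> [|v [_ v1]|u v [Bu u1] [Bv v1]]; last 2 first.
- by split.
- split; first exact: Bprod.
  move=> x /msupp_nprod[y [z [/u1 -> /v1 -> _ ->]]].
  by rewrite subr0 subrr addr0.
split; first by split=> [|x]; [case: Bsub | rewrite msupp0].
move=> k u v [Bu u1] [Bv v1]; split; first by case: Bsub => _; apply.
move=> x /(fsubsetP (msuppD_le _ _)); rewrite in_fsetE => /orP[|/v1//].
by move=> /(fsubsetP (msuppZ_le _ _)) /u1.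
Qed.

Lemma lie_derived_sub A W : vsubspace W ->
  (forall u v, A u -> A v -> W (bracket u v)) -> lie_derived eps A `<=` W.
Proof.
move=> Wsub AW _ [m [w [k [wA ->]]]].
elim/big_ind: _ => [|u v Wu Wv|i _]; first by case: Wsub.
  by rewrite -[u]scale1r; case: Wsub => _; apply.
by have [u Au [v Av <-]] := wA i; apply: vsubspaceZ => //; exact: AW.
Qed.

(** F j is the part of (V_B)_1 in height at least j.  The bracket of two vectors
    of F j lies in F (j + 1): heights add up for j > 0, and for j = 0 the height
    0 is not reached, because the Cartan subalgebra is abelian and B contains
    no pair of opposite roots. *)
Lemma solvable_VB1 B : borel_type B -> lie_solvable eps (weight_one (Vsub B)).
Proof.
move=> Bborel; have [Bmon _ Banti _] := Bborel.
have [g gpos] := positive_rootset_height (borel_type_roots Bborel).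
have [K gK] := root_height_bound g.
pose F (j : nat) := weight_one (Vsub B) `&`
  [set v | forall x, x \in msupp v -> j%:Z <= lipz g x.2].
have [[W0 WD] _ Wbr] := lie_subalgebra_VB1 Bmon.
have Fsub j : vsubspace (F j).
  split=> [|k u v [Wu uj] [Wv vj]]; first by split=> // x; rewrite msupp0.
  split; first exact: WD.
  move=> x /(fsubsetP (msuppD_le _ _)); rewrite in_fsetE => /orP[|/vj//].
  by move=> /(fsubsetP (msuppZ_le _ _)) /uj.
have F0 v : weight_one (Vsub B) v -> F 0%N v.
  move=> Wv; split=> // x xv.
  have [Bv v1] := Wv.
  have [[-> _]|[_ rx]] := weight_one_pbw (v1 _ xv); first by rewrite lipz0r.
  by apply/ltW/gpos; split=> //; exact: Bv.
have Fbr j u v : F j u -> F j v -> F j.+1 (bracket u v).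
  move=> [Wu uj] [Wv vj]; have Wuv := Wbr _ _ Wu Wv; split=> // x xuv.
  have [Bx x1] := Wuv.
  have [y yu xY] := msupp_nprod_term xuv.
  have [z zv [xE _]] := shifted_Ypbw xY.
  case: j uj vj => [|j] uj vj; last first.
    by rewrite xE lipzDr; have := uj _ yu; have := vj _ zv; lia.
  have [[x0 _]|[_ rx]] := weight_one_pbw (x1 _ xuv); last first.
    by apply: gpos; split=> //; exact: Bx.
  (* Both [y.2] and its opposite [z.2] lie in [B], so [y] is a Cartan vector,
     whose action kills the degree [x.2 = 0]. *)
  have y0 : y.2 = 0.
    have : (B `&` [set - a | a in B]) y.2.
      split; first by case: Wu => Bu _; exact: Bu.
      exists z.2; first by case: Wv => Bv _; exact: Bv.
      by apply/esym/eqP; rewrite -addr_eq0 addrC -xE; apply/eqP.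
    by rewrite Banti.
  have [_ u1] := Wu.
  have [[_ [i y1]]|[_ /lroots_neq0]] := weight_one_pbw (u1 _ yu); last first.
    by rewrite y0 eqxx.
  have yE : y = ([mset (i, 0%N)]%mset, 0) by rewrite -y1 -y0; case: (y).
  have hb0 : hip (hb i) (hvec_of (0 : lvec L)) = 0.
    rewrite hvec_of0; apply: big1 => l _; apply: big1 => l' _.
    by rewrite [X in _ * X * _]mxE mulr0 mul0r.
  move: xY; rewrite yE (Ypbw_cartan heps) -mcoeff_neq0 mcoeff_hmode0 x0 hb0.
  by rewrite mul0r eqxx.
have iterF k : iter k (lie_derived eps) (weight_one (Vsub B)) `<=` F k.
  elim: k => [|k IHk]; first exact: F0.
  rewrite iterS; apply: lie_derived_sub => // u v /IHk uk /IHk vk.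
  exact: Fbr.
exists K.+1 => v /iterF[[_ v1] vK].
apply/malgP => x; rewrite mcoeff0; apply/mcoeff_outdom/negP => xv.
have := vK _ xv.
have [[-> _]|[_ rx]] := weight_one_pbw (v1 _ xv); first by rewrite lipz0r.
by have := gK _ rx; lia.
Qed.

(** If the height vanishes then S is empty, and any root can define B. *)
Lemma positive_rootset_sub_borel S : lroots L !=set0 -> positive_rootset S ->
  exists2 B, borel_type B & S `<=` B.
Proof.
move=> [r rr] /positive_rootset_height[g gS].
have [g0|g0] := eqVneq g 0; last first.
  by have [B Bborel gB] := borel_type_extends g0; exists B => // a /gS /gB.
have [B Bborel _] := borel_type_extends (lroots_neq0 rr).
by exists B => // a /gS; rewrite g0 lipzC lipz0r ltxx.
Qed.

(** Maximality turns the inclusion A `<=` (V_B)_1 into an equality. *)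
Lemma lie_borel_VB1 A : lroots L !=set0 -> lie_borel eps A -> cartan L `<=` A ->
  exists2 B, borel_type B & A = weight_one (Vsub B).
Proof.
move=> Phi0 [Alie Asolv Amax] hA.
have [B Bborel SB] :=
  positive_rootset_sub_borel Phi0 (lie_subalgebra_rootset Alie Asolv).
exists B => //; have [Bmon _ _ _] := Bborel.
apply/esym/Amax; [exact: lie_subalgebra_VB1 | exact: solvable_VB1 |].
move=> v Av; have [_ AVL1 _] := Alie; have [_ v1] := AVL1 _ Av.
split=> // x xv.
have [->|x0] := eqVneq x.2 0; first by case: Bmon.
exact/SB/(expvec_mem_of_supp Alie hA Av xv x0).
Qed.

End WeightOne.

Theorem proposition4p2 (R : realType) (L : evenLattice R)
    (eps : lvec L -> lvec L -> int) (heps : cocycle eps)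
    (hPhi : lroots L !=set0)
    (k m : nat) (Delta : k.-tuple (lvec L)) (ext : m.-tuple (lvec L))
    (hDelta : root_basis Delta)
    (hbasis : basis_of fullv (map (@emb _ L) (Delta ++ ext)))
    (hL : forall x : lvec L, exists! qc : lvec L * {ffun 'I_m -> int},
        root_lattice qc.1 /\ x = qc.1 + \sum_(j < m) qc.2 j *: tnth ext j) :
  (forall bb : set (VL L), lie_borel eps bb -> cartan L `<=` bb ->
     exists2 W : set (VL L), borel_subVOA eps W & bb = weight_one W) /\
  (forall pp : set (VL L), lie_parabolic eps pp -> cartan L `<=` pp ->
     exists2 W : set (VL L), parabolic_subVOA eps W & pp `<=` weight_one W).
Proof.
split=> [bb bb_borel h_bb|pp [[_ ppVL1 _] _] _].
  have [B Bborel bbE] := lie_borel_VB1 heps hPhi bb_borel h_bb.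
  have [Bmon _ _ _] := Bborel.
  by exists (Vsub B) => //; split; [exact: Vsub_subVOA | exists B].
have LT : submonoid [set: lvec L] by [].
exists (Vsub setT); last by move=> v /ppVL1[_ v1]; split.
split; first exact: Vsub_subVOA.
exists setT => //; split=> //.
case: hPhi => r rr.
by have [B Bborel _] := borel_type_extends (lroots_neq0 rr); exists B.
Qed.
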